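(* Let $G$ be a group of order $n$, written additively, and suppose $A_1,\ldots,A_m$ is a partition of $G^*=G\setminus\{0\}$ such that, for $1\le h\le \ell$, there are exactly $c_h$ of the subsets of size $k_h$ (the $k_h$ distinct, $m=\sum_h c_h$). Then $A_1,\ldots,A_m$ is an $(n,m;c_1,\ldots,c_\ell;k_1,\ldots,k_\ell;\lambda_1,\ldots,\lambda_\ell)$-partitioned external difference family if and only if, for each $1\le h\le\ell$, the subsets of cardinality $k_h$ form an $(n,c_h,k_h,c_hk_h-\lambda_h-1,c_hk_h-\lambda_h)$-disjoint partial difference family in $G$.
   Context: For $D\subseteq G$, $\Delta(D)$ is the multiset $\{x-y: x,y\in D,\ x\neq y\}$; for disjoint $D_1,D_2$, $\Delta(D_1,D_2)$ is the multiset $\{x-y:x\in D_1,y\in D_2\}$; $\lambda A$ is the multiset with $\lambda$ copies of each element of $A$. A collection of disjoint subsets $A_1,\dots,A_m$ of $G$, comprising $c_h$ subsets of size $k_h$ ($1\le h\le\ell$), is an $(n,m;c_1,\ldots,c_\ell;k_1,\ldots,k_\ell;\lambda_1,\ldots,\lambda_\ell)$-partitioned external difference family (PEDF) if for each $1\le h\le\ell$ the multiset equation $\bigcup_{i:|A_i|=k_h}\bigcup_{j\neq i}\Delta(A_i,A_j)=\lambda_h G^*$ holds. A collection $\{D_1,\dots,D_c\}$ of disjoint $k$-subsets of $G^*$ with $S=\bigcup_i D_i$ is an $(n,c,k,\lambda,\mu)$-disjoint partial difference family if $\bigcup_{i}\Delta(D_i)=\lambda S+\mu(G^*\setminus S)$.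 *)

(* Defs.v *)
From HB Require Import structures.
From mathcomp Require Import all_boot all_order all_algebra all_fingroup.
Set Implicit Arguments.
Unset Strict Implicit.
Unset Printing Implicit Defensive.

Local Open Scope group_scope.

(* The group need not be abelian: the additive x - y, 0 and G \ {0} are       *)
(* rendered as x * y^-1, 1 and [set: gT]^#.  A multiset of group elements is  *)
(* given by its multiplicity function.                                        *)

Section DifferenceFamilies.

Variable gT : finGroupType.
Implicit Types (A B D : {set gT}) (P F : {set {set gT}}) (g : gT).

Definition Delta D g : nat :=
  #|[set p in setX D D | (p.1 != p.2) && (p.1 * p.2^-1 == g)]|.

Definition Delta2 A B g : nat :=
  #|[set p in setX A B | p.1 * p.2^-1 == g]|.

Definition copies (lam : nat) A g : nat := (lam * (g \in A))%N.

Definition of_size P (k : nat) : {set {set gT}} := [set A in P | #|A| == k].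

Definition is_PEDF (n m l : nat) (c k lam : 'I_l -> nat) P : Prop :=
  [/\ #|gT| = n, #|P| = m /\ m = (\sum_(h < l) c h)%N, trivIset P,
      injective k /\ (forall h, #|of_size P (k h)| = c h)
    & forall h g,
        (\sum_(A in of_size P (k h)) \sum_(B in P | B != A) Delta2 A B g)%N
        = copies (lam h) [set: gT]^# g].

(* The parameters lam and mu are integers so that values such as              *)
(* c * k - lam - 1 are not truncated at 0.  The equation itself forces        *)
(* 0 <= lam when S is nonempty, and 0 <= mu when [set: gT]^# :\: S is.        *)
Definition is_DPDF (n c k : nat) (lam mu : int) F : Prop :=
  let S := cover F in
  [/\ #|gT| = n, #|F| = c, trivIset F,
      forall D, D \in F -> D \subset [set: gT]^# /\ #|D| = k
    & forall g,
        ((\sum_(D in F) Delta D g)%N%:Z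
         = lam * (g \in S)%:Z + mu * (g \in [set: gT]^# :\: S)%:Z)%R].

End DifferenceFamilies.

(* Main.v *)
(** For [g != 1] and [A] in [P], every [x] in [A] other than [g] is written
    uniquely as [x = g * y] with [y] in some block of [P], so the differences
    from [A] to all the blocks hit [g] exactly [#|A| - (g \in A)] times.  Summed
    over the [c] blocks of size [k], the external differences, the internal
    differences and [(g \in S)] add up to [c * k]: each family of differences
    determines the other.  At [g = 1] all the multiplicities vanish. *)
Require Import Defs.
From HB Require Import structures.
From mathcomp Require Import all_boot all_order all_algebra all_fingroup zify.

Set Implicit Arguments.
Unset Strict Implicit.
Unset Printing Implicit Defensive.

Section ExternalInternal.

Variable gT : finGroupType.
Implicit Types (A B D : {set gT}) (P F : {set {set gT}}) (g : gT).

Local Open Scope group_scope.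

(** A pair with difference [g] is determined by its first entry [x], the second being [g^-1 * x];
    the double count becomes a sum over [A] alone. *)
Lemma Delta2E A B g : Delta2 A B g = (\sum_(x in A) (g^-1 * x \in B)%g)%N.
Proof.
rewrite -big_mkcondr sum1_card /Delta2.
have inj_f : injective (fun x => (x, g^-1 * x)) by move=> x y [].
rewrite -(card_imset _ inj_f).
apply: eq_card => -[x y]; rewrite !inE /=.
apply/andP/imsetP => [[/andP[Ax By] /eqP <-]|[z /andP[Az Bz] [-> ->]]].
  have y_eq : (x * y^-1)^-1 * x = y by rewrite invMg invgK mulgKV.
  by exists x; rewrite ?y_eq // unfold_in Ax y_eq.
by rewrite Az Bz invMg invgK mulKVg eqxx.
Qed.

Lemma Delta_neq1 D g : g != 1 -> Delta D g = Delta2 D D g.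
Proof.
move=> g_neq1; apply: eq_card => -[x y]; rewrite !inE /=.
case: (x =P y) => //= ->; rewrite mulgV [1 == g]eq_sym (negPf g_neq1).
by rewrite andbF.
Qed.

Lemma Delta1 D : Delta D 1 = 0%N.
Proof.
apply: eq_card0 => -[x y]; rewrite !inE /=.
by rewrite -eq_mulgV1 andNb andbF.
Qed.

Lemma Delta2_disjoint1 A B : [disjoint A & B] -> Delta2 A B 1 = 0%N.
Proof.
move=> dAB; rewrite Delta2E big1 // => x Ax.
by rewrite invg1 mul1g (disjointFr dAB Ax).
Qed.

(** By disjointness only [pblock P y] can contribute. *)
Lemma sum_mem_trivIset (T : finType) (P : {set {set T}}) (y : T) :
  trivIset P -> (\sum_(B in P) (y \in B) = (y \in cover P))%N.
Proof.
move=> tiP; case: (boolP (y \in cover P)) => [Py | nPy].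
  rewrite (bigD1 (pblock P y)) ?pblock_mem //= mem_pblock Py big1 // => B.
  case/andP=> PB; apply: contraNeq; rewrite eqb0 negbK => By.
  by rewrite (def_pblock tiP PB By).
rewrite big1 // => B PB; apply/eqP; rewrite eqb0.
by apply: contra nPy => By; apply/bigcupP; exists B.
Qed.

Lemma sum_Delta2_partition P A g :
  partition P [set: gT]^# ->
  (\sum_(B in P) Delta2 A B g + (g \in A) = #|A|)%N.
Proof.
case/and3P=> /eqP covP tiP _.
under eq_bigr do rewrite Delta2E.
rewrite exchange_big /=.
(* Since [P] covers all elements but [1], the term of [x] is 1 unless [g^-1 * x = 1], that is,
   [x = g]. *)
under eq_bigr do rewrite sum_mem_trivIset // covP !inE andbT -eq_invg_mul invgK.
have -> : (g \in A) = (\sum_(x in A) (g == x))%N :> nat.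
  case: (boolP (g \in A)) => Ag.
    rewrite (bigD1 g) //= eqxx big1 // => x /andP[_].
    by rewrite eq_sym => /negPf->.
  by rewrite big1 // => x Ax; case: eqP Ax Ag => // -> ->.
by rewrite -big_split /= -sum1_card; apply: eq_bigr => x _; case: eqP.
Qed.

Lemma external_internal_sum P F (k : nat) g :
  partition P [set: gT]^# -> F \subset P ->
  (forall A, A \in F -> #|A| = k) -> g != 1 ->
  (\sum_(A in F) \sum_(B in P | B != A) Delta2 A B g
    + \sum_(A in F) Delta A g + (g \in cover F) = #|F| * k)%N.
Proof.
move=> partP /subsetP sFP cardF g_neq1.
have tiF : trivIset F.
  by case/and3P: partP => _ tiP _; apply: trivIsetS tiP; apply/subsetP.
(* With [g \in cover F] also spread over the blocks of [F], the identity can be checked block by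
   block. *)
rewrite -sum_mem_trivIset // -!big_split -sum_nat_const /=.
apply: eq_bigr => A FA; rewrite -(cardF A FA) Delta_neq1 //.
(* The term [B = A] of the sum over all blocks is the internal difference count. *)
rewrite -(sum_Delta2_partition A g partP) [in RHS](bigD1 A) ?sFP //=.
by rewrite [(Delta2 A A g + _)%N]addnC.
Qed.

Lemma external_sum1 P F :
  trivIset P -> F \subset P ->
  (\sum_(A in F) \sum_(B in P | B != A) Delta2 A B 1%g = 0)%N.
Proof.
move=> /trivIsetP tiP /subsetP sFP.
rewrite big1 // => A FA; rewrite big1 // => B /andP[PB nBA].
by apply/Delta2_disjoint1/tiP => //; [apply: sFP | rewrite eq_sym].
Qed.

Lemma internal_sum1 F : (\sum_(A in F) Delta A 1%g = 0)%N.
Proof. by rewrite big1 // => A _; apply: Delta1. Qed.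

(** The equivalence holds separately for each [g] and each block size, so both directions of the
    theorem reduce to it. *)
Lemma external_internal_equiv P F (k lam : nat) g :
  partition P [set: gT]^# -> F \subset P ->
  (forall A, A \in F -> #|A| = k) ->
  (\sum_(A in F) \sum_(B in P | B != A) Delta2 A B g
     = copies lam [set: gT]^# g)%N <->
  ((\sum_(A in F) Delta A g)%N%:Z
     = ((#|F| * k)%N%:Z - lam%:Z - 1) * (g \in cover F)%:Z
       + ((#|F| * k)%N%:Z - lam%:Z)
         * (g \in [set: gT]^# :\: cover F)%:Z)%R.
Proof.
move=> partP sFP cardF; have /and3P[/eqP covP tiP _] := partP.
have [->|g_neq1] := eqVneq g 1.
  (* No block contains [1], so both indicators on the right vanish. *)
  have -> : 1 \in cover F = false.
    apply/bigcupP => -[A /(subsetP sFP) PA A1].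
    have : 1 \in cover P by apply/bigcupP; exists A.
    by rewrite covP !inE eqxx.
  rewrite external_sum1 // internal_sum1 /copies !inE eqxx andbF /= muln0.
  by split=> // _; rewrite !GRing.mulr0.
have := external_internal_sum partP sFP cardF g_neq1.
rewrite /copies !inE g_neq1 andbT /=.
(* The extra [- 1] in the coefficient on [cover F] is the term [(g \in cover F)] of the counting
   identity. *)
by case: (g \in cover F) => /=; lia.
Qed.

End ExternalInternal.

Theorem theorem2p9 (gT : finGroupType) (n m l : nat)
    (c k lam : 'I_l -> nat) (P : {set {set gT}})
    (cardG : #|gT| = n)
    (partP : partition P ([set: gT]^#)%g)
    (cardP : #|P| = m)
    (inj_k : injective k)
    (cardPk : forall h : 'I_l, #|of_size P (k h)| = c h)
    (sum_c : m = \sum_(h < l) c h) :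
  is_PEDF n m c k lam P <->
  (forall h : 'I_l,
     is_DPDF n (c h) (k h)
       ((c h * k h)%N%:Z - (lam h)%:Z - 1)%R
       ((c h * k h)%N%:Z - (lam h)%:Z)%R
       (of_size P (k h))).
Proof.
have /and3P[/eqP covP tiP _] := partP.
have sizeP h A : A \in of_size P (k h) -> #|A| = k h.
  by rewrite inE => /andP[_ /eqP].
have subP h : of_size P (k h) \subset P.
  by apply/subsetP => A; rewrite inE => /andP[].
have equiv h g := external_internal_equiv (lam h) g partP (subP h) (@sizeP h).
split=> [[_ _ _ _ ext] h | dpdf].
  split=> //; first exact: trivIsetS (subP h) tiP.
    move=> D FD; split; last exact: sizeP FD.
    by rewrite -covP; apply: bigcup_sup; apply: (subsetP (subP h)).
  by move=> g; rewrite -(cardPk h); apply/equiv/ext.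
split=> // h g; apply/equiv.
by case: (dpdf h) => _ _ _ _ /(_ g); rewrite -(cardPk h).
Qed.
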